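(* Let $X$ and $Y$ be normed vector spaces over $\mathbb{R}$ with norms $\|\cdot\|_X$ and $\|\cdot\|_Y$, let $\Omega\subseteq X$ be open, and let $f:\Omega\to Y$ be a function. If $f$ is Fréchet differentiable at $x\in\Omega$ with Fréchet differential $Df(x)$, then $f$ is specularly Fréchet differentiable at $x$, and its specular Fréchet differential satisfies $\widehat{D}f(x)=Df(x)$.
   Context: $\mathcal{L}(X;Y)$ is the space of continuous linear operators $X\to Y$. The product norm is $\|(x,y)\|_{X\times Y}:=(\|x\|_X^2+\|y\|_Y^2)^{1/2}$. $f$ is specularly Fréchet differentiable at $x\in\Omega$ if there exists $\ell\in\mathcal{L}(X;Y)$ such that $$\lim_{\|w\|_X\to 0}\left\|\frac{f(x+w)-f(x)-\ell(w)}{\|w\|_X}\cdot\frac{\|J\|_{X\times Y}}{\|J\|_{X\times Y}+\|K\|_{X\times Y}}+\frac{f(x)-f(x-w)-\ell(w)}{\|w\|_X}\cdot\frac{\|K\|_{X\times Y}}{\|J\|_{X\times Y}+\|K\|_{X\times Y}}\right\|_Y=0$$ (limit over nonzero $w\in X$), where $J:=(w,f(x)-f(x-w))$ and $K:=(w,f(x+w)-f(x))$. Such an $\ell$ is called the specular Fréchet differential of $f$ at $x$ and is denoted $\widehat{D}f(x)$. *)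

(* Defs.v *)
From mathcomp Require Import all_boot all_order all_algebra.
From mathcomp Require Import all_classical all_reals all_analysis.

Set Implicit Arguments.
Unset Strict Implicit.
Unset Printing Implicit Defensive.

Import Order.TTheory GRing.Theory Num.Theory.
Import numFieldNormedType.Exports.

Local Open Scope classical_set_scope.
Local Open Scope ring_scope.

(* Euclidean product norm; the norm that the library puts on [X * Y] is the
   maximum of the two norms. *)
Definition prod_norm2 (R : realType) (X Y : normedModType R)
    (p : (X * Y)%type) : R :=
  Num.sqrt (`|p.1| ^+ 2 + `|p.2| ^+ 2).

(* The quantity whose norm has to vanish as [w] tends to 0. The backward
   increment enters [J], which weights the forward quotient, and conversely. *)
Definition specular_quotient (R : realType) (X Y : normedModType R)
    (f : X -> Y) (x : X) (l : X -> Y) (w : X) : Y :=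
  let J : (X * Y)%type := (w, f x - f (x - w)) in
  let K : (X * Y)%type := (w, f (x + w) - f x) in
  let nJ := prod_norm2 J in
  let nK := prod_norm2 K in
  (nJ / (nJ + nK)) *: (`|w|^-1 *: (f (x + w) - f x - l w))
  + (nK / (nJ + nK)) *: (`|w|^-1 *: (f x - f (x - w) - l w)).

(* Only the values of [f] near [x] matter, so for a map given on an open set
   containing [x], any extension of it to [X] may be used. *)
Definition is_specular_diff (R : realType) (X Y : normedModType R)
    (f : X -> Y) (x : X) (l : {linear X -> Y}) : Prop :=
  continuous l /\ `|specular_quotient f x l w| @[w --> 0^'] --> (0 : R).

Definition specular_differentiable (R : realType) (X Y : normedModType R)
    (f : X -> Y) (x : X) : Prop :=
  exists l : {linear X -> Y}, is_specular_diff f x l.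

(* Main.v *)
Require Import Defs.
From mathcomp Require Import all_boot all_order all_algebra.
From mathcomp Require Import all_classical all_reals all_analysis.
Import Order.TTheory GRing.Theory Num.Theory.
Import numFieldNormedType.Exports.
Local Open Scope classical_set_scope.
Local Open Scope ring_scope.

(** The specular quotient is a convex combination of the normalized errors
    of the forward and the backward linear approximation of [f] by [l]: the
    two weights are nonnegative and add up to 1, whatever [f] is. Fréchet
    differentiability makes both errors small for [l = 'd f x], the backward
    one because [w] can be replaced by [- w]; hence so is their convex
    combination, and [l = 'd f x] is a specular differential.

    For uniqueness, the weights do not depend on [l], so that the quotients
    for two maps [l] and [l'] differ by exactly [`|w|^-1 *: (l' w - l w)].
    If both are specular differentials, the linear map [l' - l] is therefore
    [o(w)] at 0, and a homogeneous map with this property is zero. *)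

(** For [w != 0] the weights have a positive denominator and so add up to 1.
    At [w = 0] both increments vanish and the weights are 0. *)
Lemma prod_norm2_gt0 (R : realType) (X Y : normedModType R) (w : X) (y : Y) :
  w != 0 -> 0 < prod_norm2 (w, y).
Proof.
move=> w0; rewrite sqrtr_gt0 ltr_pwDl// ?exprn_ge0//.
by rewrite exprn_gt0// normr_gt0.
Qed.

(** The weights depend on the increments of [f] alone, so in the difference
    they multiply the same vector [`|w|^-1 *: (l' w - l w)], and they add up
    to 1. *)
Lemma specular_quotientB (R : realType) (X Y : normedModType R)
    (f : X -> Y) (x : X) (l l' : X -> Y) (w : X) : w != 0 ->
  specular_quotient f x l w - specular_quotient f x l' w =
  `|w|^-1 *: (l' w - l w).
Proof.
move=> w0; rewrite /specular_quotient.
set J := prod_norm2 (w, f x - _); set K := prod_norm2 (w, f (x + w) - _).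
have J0 : 0 < J by exact: prod_norm2_gt0.
have K0 : 0 < K by exact: prod_norm2_gt0.
have abE : J / (J + K) + K / (J + K) = 1.
  by rewrite -mulrDl divff// gt_eqF// addr_gt0.
rewrite opprD addrACA -!scalerBr.
have cancel (u v t : Y) : u - v - (u - t) = t - v.
  by rewrite opprB addrC addrA subrK.
by rewrite !cancel -scalerDl abE scale1r.
Qed.

(** A convex combination of two vectors of norm at most [e] has norm at most
    [e]. *)
Lemma norm_specular_quotient_le (R : realType) (X Y : normedModType R)
    (f : X -> Y) (x : X) (l : X -> Y) (w : X) (e : R) : w != 0 ->
  `|f (x + w) - f x - l w| <= e * `|w| ->
  `|f x - f (x - w) - l w| <= e * `|w| ->
  `|specular_quotient f x l w| <= e.
Proof.
move=> w0 forward backward; rewrite /specular_quotient.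
set J := prod_norm2 (w, f x - _); set K := prod_norm2 (w, f (x + w) - _).
have J0 : 0 < J by exact: prod_norm2_gt0.
have K0 : 0 < K by exact: prod_norm2_gt0.
have JK0 : 0 < J + K by exact: addr_gt0.
have normalize (y : Y) : `|y| <= e * `|w| -> `|(`|w|^-1 *: y)| <= e.
  by move=> ye; rewrite normrZ normfV normr_id mulrC ler_pdivrMr// normr_gt0.
have a0 : 0 <= J / (J + K) by rewrite divr_ge0 ?ltW.
have b0 : 0 <= K / (J + K) by rewrite divr_ge0 ?ltW.
have eE : e = J / (J + K) * e + K / (J + K) * e.
  by rewrite -!mulrDl divff ?mul1r// gt_eqF.
apply: (le_trans (ler_normD _ _)).
rewrite eE !(normrZ (_ / _)) !ger0_norm//.
by apply: lerD; apply: ler_wpM2l => //; exact: normalize.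
Qed.

(** The backward error at [w] is, up to sign, the forward error at [- w]. *)
Lemma differentiable_two_sided (R : realType) (X Y : normedModType R)
    (f : X -> Y) (x : X) (e : R) : differentiable f x -> 0 < e ->
  \forall w \near (0 : X),
    `|f (x + w) - f x - 'd f x w| <= e * `|w| /\
    `|f x - f (x - w) - 'd f x w| <= e * `|w|.
Proof.
move=> df e0.
have forward : \forall w \near (0 : X),
    `|f (x + w) - f x - 'd f x w| <= e * `|w|.
  have /eqaddoP fo := diff_locally df.
  have := fo e e0; apply: filterS => w /=; rewrite !fctE /=.
  by rewrite (addrC w) opprD addrA.
have backward : \forall w \near (0 : X),
    `|f (x - w) - f x - 'd f x (- w)| <= e * `|(- w)|.
  have cvgN : - w @[w --> (0 : X)] --> (0 : X).
    by rewrite -[X in _ --> X]oppr0; apply: cvgN.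
  exact: (cvgN _ forward).
near=> w; split; first by near: w.
have : `|f (x - w) - f x - 'd f x (- w)| <= e * `|(- w)| by near: w.
by rewrite linearN opprK normrN -(normrN (_ + _)) opprD opprB.
Unshelve. all: by end_near. Qed.

Lemma differentiable_is_specular_diff (R : realType) (X Y : normedModType R)
    (f : X -> Y) (x : X) : differentiable f x -> is_specular_diff f x ('d f x).
Proof.
move=> df; split; first exact: diff_continuous.
apply/cvgr0Pnorm_le => e e0; near=> w.
have w0 : w != 0 by near: w; exact: nbhs_dnbhs_neq.
rewrite normr_id.
suff [] : `|f (x + w) - f x - 'd f x w| <= e * `|w| /\
    `|f x - f (x - w) - 'd f x w| <= e * `|w|.
  exact: norm_specular_quotient_le.
by near: w; apply: nbhs_dnbhs; exact: differentiable_two_sided.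
Unshelve. all: by end_near. Qed.

(** By homogeneity the ratio [`|g v| / `|v|] is constant along the ray spanned
    by [v], hence equal to its limit at 0. *)
Lemma homogeneous_littleo_eq0 (R : realType) (X Y : normedModType R)
    (g : X -> Y) : (forall (t : R) v, g (t *: v) = t *: g v) ->
  (forall e : R, 0 < e -> \forall w \near 0^', `|g w| <= e * `|w|) ->
  forall v, g v = 0.
Proof.
move=> gZ go v; have [->|v0] := eqVneq v 0.
  by rewrite -[X in g X](scale0r 0) gZ scale0r.
apply/eqP; rewrite -normr_le0; apply/ler_addgt0Pl => e e0; rewrite addr0.
have nv0 : 0 < `|v| by rewrite normr_gt0.
have ray : \forall t \near (0 : R),
    t *: v != 0 -> `|g (t *: v)| <= e / `|v| * `|t *: v|.
  have A0 : \forall w \near (0 : X), w != 0 -> `|g w| <= e / `|v| * `|w|.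
    by apply: go; rewrite divr_gt0.
  exact: (near0Z v A0).
have [t [t0 gt]] : exists t : R,
    t != 0 /\ `|g (t *: v)| <= e / `|v| * `|t *: v|.
  apply: (@filter_ex _ (0 : R)^'); near=> t.
  have t0 : t != 0 by near: t; exact: nbhs_dnbhs_neq.
  split=> //; have : t *: v != 0 by rewrite scaler_eq0 negb_or t0.
  by near: t; apply: nbhs_dnbhs; exact: ray.
move: gt; rewrite gZ !normrZ mulrCA ler_pM2l ?normr_gt0//.
by rewrite divfK ?gt_eqF.
Unshelve. all: by end_near. Qed.

Lemma is_specular_diff_unique (R : realType) (X Y : normedModType R)
    (f : X -> Y) (x : X) (l l' : {linear X -> Y}) :
  is_specular_diff f x l -> is_specular_diff f x l' -> l = l' :> (X -> Y).
Proof.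
move=> [_ /cvgr0Pnorm_le ql] [_ /cvgr0Pnorm_le ql']; apply/funext => v; apply/esym/eqP.
rewrite -subr_eq0; apply/eqP; move: v.
apply: (@homogeneous_littleo_eq0 _ _ _ (fun v => l' v - l v)).
  by move=> t v; rewrite !linearZ scalerDr.
move=> e e0; have e20 : 0 < e / 2 by rewrite divr_gt0.
near=> w.
have w0 : w != 0 by near: w; exact: nbhs_dnbhs_neq.
have qlw : `|specular_quotient f x l w| <= e / 2.
  by rewrite -normr_id; near: w; exact: ql.
have ql'w : `|specular_quotient f x l' w| <= e / 2.
  by rewrite -normr_id; near: w; exact: ql'.
have : `|(`|w|^-1 *: (l' w - l w))| <= e.
  rewrite -(specular_quotientB _ _ _ f x l l')// (splitr e).
  by rewrite (le_trans (ler_normB _ _))// lerD.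
by rewrite normrZ normfV normr_id mulrC ler_pdivrMr// normr_gt0.
Unshelve. all: by end_near. Qed.

Theorem proposition5p2 (R : realType) (X Y : normedModType R)
    (Omega : set X) (hOmega : open Omega) (f : X -> Y)
    (x : X) (hx : Omega x) (hf : differentiable f x) :
  specular_differentiable f x /\
  (forall l : {linear X -> Y}, is_specular_diff f x l ->
    l = 'd f x :> (X -> Y)).
Proof.
have dfx := differentiable_is_specular_diff _ _ _ _ _ hf.
split; first by exists ('d f x).
by move=> l lP; exact: (is_specular_diff_unique _ _ _ _ _ _ _ lP dfx).
Qed.
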